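(* Let $G$ be a block graph. Then $o(G)=\mathcal{D}$ if and only if $G$ admits a perfect $[1,2]$-factor.
   Context: All graphs are finite and simple. A $2$-connected graph is a connected graph that remains connected after the removal of any vertex; a $2$-connected component of a graph is a maximal $2$-connected subgraph of it. A block graph is a graph in which every $2$-connected component is a clique. A perfect $[1,2]$-factor of a graph $G$ is a spanning subgraph of $G$ (a subgraph with the same vertex set) each of whose connected components is either a single edge $K_2$ or a cycle $C_n$, $n\ge 3$. The Maker-Breaker domination game on a graph $G$: two players, Dominator and Staller, alternately claim a not-yet-claimed vertex of $G$. Dominator wins if at some point the vertices she has claimed form a dominating set of $G$. Otherwise, i.e. if Staller manages to claim a vertex and all its neighbors, Staller wins. The graph $G$ has outcome $\mathcal{D}$, written $o(G)=\mathcal{D}$, if Dominator has a winning strategy whoever starts (equivalently, if Dominator has a winning strategy when playing second, since no player benefits from skipping a turn). *)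

(* Defs.v *)
From mathcomp Require Import all_boot.

Set Implicit Arguments.
Unset Strict Implicit.
Unset Printing Implicit Defensive.

(* A finite simple graph is a symmetric irreflexive relation
   [e : rel T] on a finType [T]. *)

Record subgraph (T : finType) (e : rel T) := Subgraph {
  sg_vert : {set T};
  sg_edge : rel T;
  sg_sym : symmetric sg_edge;
  sg_sub : forall x y, sg_edge x y ->
             [/\ e x y, x \in sg_vert & y \in sg_vert]
}.

Definition subgraph_le (T : finType) (e : rel T) (H K : subgraph e) : Prop :=
  sg_vert H \subset sg_vert K /\
  (forall x y, sg_edge H x y -> sg_edge K x y).

(* Paths may not leave [V], so [connected_on (V :\ x) f] is connectedness
   after deleting [x].  The graph without vertices counts as connected, which
   makes K_1 2-connected; the resulting extra 2-connected components are
   cliques, so [block_graph] does not depend on this convention. *)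
Definition connected_on (T : finType) (V : {set T}) (f : rel T) : Prop :=
  forall x y, x \in V -> y \in V ->
    connect [rel u v | [&& u \in V, v \in V & f u v]] x y.

Definition two_connected (T : finType) (e : rel T) (H : subgraph e) : Prop :=
  connected_on (sg_vert H) (sg_edge H) /\
  (forall x, x \in sg_vert H -> connected_on (sg_vert H :\ x) (sg_edge H)).

Definition two_connected_component (T : finType) (e : rel T)
    (H : subgraph e) : Prop :=
  two_connected H /\
  (forall K : subgraph e, two_connected K -> subgraph_le H K ->
     subgraph_le K H).

Definition clique (T : finType) (e : rel T) (H : subgraph e) : Prop :=
  forall x y, x \in sg_vert H -> y \in sg_vert H -> x != y -> sg_edge H x y.

Definition block_graph (T : finType) (e : rel T) : Prop :=
  forall H : subgraph e, two_connected_component H -> clique H.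

Definition is_K2 (T : finType) (V : {set T}) (f : rel T) : Prop :=
  exists x y, [/\ x != y, V = [set x; y] & f x y].

Definition is_cycle (T : finType) (V : {set T}) (f : rel T) : Prop :=
  exists c : seq T,
    [/\ uniq c, 3 <= size c, V = [set x in c] &
        {in V &, forall x y, f x y = (y == next c x) || (x == next c y)}].

Definition perfect_12_factor (T : finType) (e : rel T)
    (F : subgraph e) : Prop :=
  sg_vert F = [set: T] /\
  (forall x : T, let C := [set y | connect (sg_edge F) x y] in
     is_K2 C (sg_edge F) \/ is_cycle C (sg_edge F)).

Definition dominating (T : finType) (e : rel T) (D : {set T}) : Prop :=
  forall v, v \notin D -> exists2 u, u \in D & e u v.

(* A play is the duplicate-free sequence of the vertices claimed so far, by
   both players, in order.  [b] tells whether Dominator moves first, and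
   [dominator_turn b i] whether she makes the move of index [i] (from 0). *)
Definition dominator_turn (b : bool) (i : nat) : bool := b (+) odd i.

Definition dominator_claims (T : finType) (b : bool) (p : seq T) : {set T} :=
  [set x in p | dominator_turn b (index x p)].

(* The option type is only there so that strategies exist when [T] is empty;
   [legal_strategy] makes Dominator move as long as a vertex is unclaimed. *)
Definition strategy (T : finType) := seq T -> option T.

Definition follows (T : finType) (b : bool) (s : strategy T) (p : seq T) :
    Prop :=
  forall i, i < size p -> dominator_turn b i -> s (take i p) = onth p i.

Definition legal_strategy (T : finType) (b : bool) (s : strategy T) : Prop :=
  forall p : seq T, uniq p -> follows b s p ->
    size p < #|T| -> dominator_turn b (size p) ->
    exists2 v, s p = Some v & v \notin p.

(* Plays are continued until all vertices are claimed; this does not affect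
   the winner, as a dominating set stays dominating when it grows. *)
Definition winning_strategy (T : finType) (e : rel T) (b : bool)
    (s : strategy T) : Prop :=
  legal_strategy b s /\
  (forall p : seq T, uniq p -> size p = #|T| -> follows b s p ->
     exists2 k, k <= size p & dominating e (dominator_claims b (take k p))).

Definition outcome_D (T : finType) (e : rel T) : Prop :=
  forall b : bool, exists s : strategy T, winning_strategy e b s.

(* Main.v *)
(* A perfect [1,2]-factor amounts to an injection [f] moving every vertex to a
   neighbour.  Given [f], Dominator wins by answering each move [x] of Staller
   within [{f x, f^-1 x}].  If there is no such [f], Hall's theorem yields an
   independent set [I] with fewer than [#|I|] neighbours.  In a block graph the
   edges between [I] and [N(I)] form a forest, and along its leaves Staller
   can force her way to the closed neighbourhood of some vertex of [I]. *)

Require Import Defs.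
From mathcomp Require Import all_boot.
From mathcomp Require Import zify.

Set Implicit Arguments.
Unset Strict Implicit.
Unset Printing Implicit Defensive.

(** * Hall's marriage theorem *)

(* Rado's argument: if [A x] contains two elements, one of them can be removed
   without breaking Hall's condition, as follows from the submodularity of the
   cardinality of unions. *)
Lemma hall_marriage (X Y : finType) (A : X -> {set Y}) :
  (forall S : {set X}, #|S| <= #|\bigcup_(x in S) A x|) ->
  exists2 f : X -> Y, injective f & forall x, f x \in A x.
Proof.
have [n] := ubnP (\sum_x #|A x|); elim: n A => // n IHn A leAn hallA.
have [/existsP[x Ax_gt1] | /existsPn A_le1] := boolP [exists x, 1 < #|A x|].
  have [y1 [y2 [Ay1 Ay2 y12]]] := card_gt1P Ax_gt1.
  pose B y z := if z == x then A x :\ y else A z.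
  have subBA y z : B y z \subset A z.
    by rewrite /B; case: eqP => [->|//]; apply: subsetDl.
  have reduce y : y \in A x ->
      (forall S : {set X}, #|S| <= #|\bigcup_(z in S) B y z|) ->
      exists2 f : X -> Y, injective f & forall z, f z \in A z.
    move=> Ay /IHn[|f f_inj fB].
      rewrite -ltnS; apply: leq_trans leAn; rewrite ltnS.
      rewrite (bigD1 x) //= [ltnRHS](bigD1 x) //= -addSn leq_add //.
        by rewrite /B eqxx [ltnRHS](cardsD1 y) Ay.
      by apply: leq_sum => z _; apply/subset_leq_card/subBA.
    by exists f => // z; apply: (subsetP (subBA y z)).
  have violator y : y \in A x ->
      ~~ [forall S : {set X}, #|S| <= #|\bigcup_(z in S) B y z|] ->
      exists2 S : {set X}, x \in S & #|\bigcup_(z in S) B y z| < #|S|.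
    move=> Ay /forallPn[S]; rewrite -ltnNge => ltS; exists S => //.
    (* On a set avoiding [x], the families [B y] and [A] agree, so Hall's condition cannot fail
       there. *)
    apply: contraLR ltS => xS; rewrite -leqNgt.
    rewrite (eq_bigr A) ?hallA // => z zS; rewrite /B ifN //.
    by apply: contraNneq xS => <-.
  case: (boolP [forall S : {set X}, #|S| <= #|\bigcup_(z in S) B y1 z|]).
    by move/forallP; apply: reduce.
  move/(violator y1 Ay1) => [S1 xS1 ltS1].
  case: (boolP [forall S : {set X}, #|S| <= #|\bigcup_(z in S) B y2 z|]).
    by move/forallP; apply: reduce.
  move/(violator y2 Ay2) => [S2 xS2 ltS2].
  pose P1 := \bigcup_(z in S1) B y1 z; pose P2 := \bigcup_(z in S2) B y2 z.
  rewrite -/P1 in ltS1; rewrite -/P2 in ltS2.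
  (* Since [y1] and [y2] differ, every element of [A x] survives in [B y1 x] or in [B y2 x]. *)
  have subU : \bigcup_(z in S1 :|: S2) A z \subset P1 :|: P2.
    apply/bigcupsP => z zS; apply/subsetP => u uA; rewrite inE.
    have [zx | zx] := eqVneq z x.
      have [uy1 | uy1] := eqVneq u y1; apply/orP; [right | left];
        apply/bigcupP; exists x => //; rewrite /B eqxx !inE -zx uA andbT //.
      by rewrite uy1.
    by case/setUP: zS => zS; apply/orP; [left | right]; apply/bigcupP;
      exists z => //; rewrite /B (negPf zx).
  have subI : \bigcup_(z in (S1 :&: S2) :\ x) A z \subset P1 :&: P2.
    apply/bigcupsP => z /setD1P[zx /setIP[zS1 zS2]]; apply/subsetP => u uA.
    by rewrite inE; apply/andP; split; apply/bigcupP;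
      exists z => //; rewrite /B (negPf zx).
  (* Adding both bounds gives $|S_1|+|S_2|-1 \le |P_1|+|P_2|$, while each [Pi] is smaller than [Si],
     so that the right side is at most $|S_1|+|S_2|-2$. *)
  have := leq_trans (hallA _) (subset_leq_card subU).
  have := leq_trans (hallA _) (subset_leq_card subI).
  have := cardsUI P1 P2; have := cardsUI S1 S2.
  rewrite (cardsD1 x (S1 :&: S2)) inE xS1 xS2; lia.
(* Now each [A x] is a singleton, and Hall's condition on pairs makes these singletons distinct. *)
have pickA x : exists y, y \in A x.
  by apply/card_gt0P; have := hallA [set x]; rewrite cards1 big_set1.
have [f fA] := fin_all_exists pickA.
exists f => // x1 x2 fx12; apply/eqP; apply: contraT => x12.
have := hallA [set x1; x2]; rewrite cards2 x12 leqNgt ltnS.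
suff -> : #|\bigcup_(x in [set x1; x2]) A x| <= 1 by [].
apply: leq_trans (_ : _ <= #|[set f x1]|) _; last by rewrite cards1.
apply/subset_leq_card/bigcupsP => x xs.
apply/subsetP => u uA; rewrite inE.
have fx : f x = f x1 by case/set2P: xs => ->.
have := A_le1 x; rewrite -fx -leqNgt => /card_le1_eqP A1.
by apply/eqP/A1.
Qed.

(** * Perfect [1,2]-factors and injections into neighbours *)

Section Graph.

Variables (T : finType) (e : rel T).
Hypotheses (e_sym : symmetric e) (e_irr : irreflexive e).

(** Let [S] violate Hall's condition and let [N] be its neighbourhood. Vertices of [S] outside [N]
    have no neighbour in [S], so [S :\: N] is independent and its neighbours lie in [N :\: S]. Both
    differences lose the same $|S \cap N|$ elements, which preserves the strict inequality. *)
Lemma deficient_independent_set :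
    (forall f : T -> T, injective f -> ~ forall x, e x (f x)) ->
  exists I : {set T}, {in I &, forall x y, ~~ e x y} /\
    #|[set y | [exists x in I, e x y]]| < #|I|.
Proof.
move=> no_f.
have [/forallP hall | /forallPn[S]] := boolP [forall S : {set T},
    #|S| <= #|\bigcup_(x in S) [set y | e x y]|].
  case: (hall_marriage hall) => f f_inj fE; case: (no_f f f_inj) => x.
  by have := fE x; rewrite inE.
rewrite -ltnNge; set N := \bigcup_(x in S) _ => ltNS.
have NP x y : x \in S -> e x y -> y \in N.
  by move=> xS exy; apply/bigcupP; exists x; rewrite ?inE.
exists (S :\: N); split=> [x y /setDP[xS xN] /setDP[yS yN]|].
  by apply: contra yN; apply: NP.
have subN : [set y | [exists x in S :\: N, e x y]] \subset N :\: S.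
  apply/subsetP => y; rewrite inE => /exists_inP[x /setDP[xS xN] exy].
  rewrite !inE (NP x) // andbT; apply: contra xN => yS.
  by apply: (NP y); rewrite // e_sym.
have := subset_leq_card subN; have := cardsID S N; have := cardsID N S.
rewrite setIC; lia.
Qed.

(** The factor joins every [x] to [f x], so its components are the orbits of the permutation [f].
    There are no fixed points, as [e] is irreflexive; orbits of size two give edges and longer ones
    give cycles. *)
Lemma factor_of_injection (f : T -> T) :
  injective f -> (forall x, e x (f x)) ->
  exists F : subgraph e, perfect_12_factor F.
Proof.
move=> f_inj fE.
pose g x y := (y == f x) || (x == f y).
have g_sym : symmetric g by move=> x y; rewrite /g orbC.
have g_sub x y : g x y -> [/\ e x y, x \in [set: T] & y \in [set: T]].
  by case/orP=> /eqP ->; rewrite !inE ?fE // e_sym fE.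
exists (Subgraph g_sym g_sub); split=> // x /=.
have connE : connect g =2 fconnect f.
  move=> a b; apply/idP/idP; apply: connect_sub => u v.
    case/orP=> /eqP ->; first exact: fconnect1.
    by rewrite fconnect_sym // fconnect1.
  by rewrite /= => /eqP <-; apply: connect1; rewrite /g eqxx.
have CE : [set y | connect g x y] = [set y in orbit f x].
  by apply/setP => y; rewrite !inE connE fconnect_orbit.
rewrite CE.
have fx_neq y : f y != y by apply: contraTneq (fE y) => ->; rewrite e_irr.
have fxo : f x \in orbit f x by rewrite -fconnect_orbit fconnect1.
have f_next y : y \in orbit f x -> f y = next (orbit f x) y.
  by move=> yo; apply/eqP; apply: (next_cycle (cycle_orbit f_inj x) yo).
have [lt2 | ] := ltnP 2 (size (orbit f x)).
  right; exists (orbit f x); split=> //.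
  by move=> u v; rewrite !inE /g => uo vo; rewrite !f_next.
left; exists x, (f x); split; first by rewrite eq_sym.
  apply/eqP; rewrite eq_sym eqEcard; apply/andP; split.
    by apply/subsetP => y /set2P[] ->; rewrite inE // -fconnect_orbit.
  by rewrite cards2 eq_sym fx_neq cardsE (card_uniqP (orbit_uniq f x)).
by rewrite /g eqxx.
Qed.

(** Each component is traversed cyclically, an edge counting as a closed walk of length two, and [f]
    moves every vertex one step forward. *)
Lemma injection_of_factor (F : subgraph e) : perfect_12_factor F ->
  exists2 f : T -> T, injective f & forall x, e x (f x).
Proof.
case=> _ comp; set g := sg_edge F in comp.
have g_sym : symmetric g by apply: sg_sym.
have conn_sym : connect_sym g by apply: sym_connect_sym.
have cycles x : exists c, [/\ uniq c, c =i connect g x & cycle g c].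
  case: (comp x) => [[a [b [ab Cab gab]]] | [c [Uc c_ge3 Cc gc]]].
    exists [:: a; b]; split=> [|y|]; rewrite /= ?inE ?ab //.
      by have /setP/(_ y) := Cab; rewrite !inE.
    by rewrite gab g_sym gab.
  have cE : c =i connect g x by move=> y; have /setP/(_ y) := Cc; rewrite !inE.
  exists c; split=> //; apply: (sub_in_cycle _ (allss c)) (cycle_next Uc).
  by move=> y z yc zc /eqP <-; rewrite gc ?eqxx // Cc inE ?mem_next.
have [c cP] := fin_all_exists cycles.
(* Going through [root] fixes one cyclic order for all vertices of a component. *)
pose f x := next (c (root g x)) x.
have inc x : x \in c (root g x).
  by have [_ -> _] := cP (root g x); rewrite inE conn_sym connect_root.
have gf x : g x (f x).
  by have [_ _ cyc] := cP (root g x); apply: next_cycle.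
exists f => [x y fxy|x]; last by have [] := sg_sub (gf x).
have rxy : root g x = root g y.
  have rf z : root g z = root g (f z).
    by apply/(rootP conn_sym)/connect1/gf.
  by rewrite rf fxy -rf.
have [Uc _ _] := cP (root g x).
by apply: (can_inj (prev_next Uc)); move: fxy; rewrite /f rxy.
Qed.

(** * Dominator's strategy *)

(* Dominator answers [x] by [f x] if it is free and otherwise by the preimage
   of [x] if that one is free.  If [f x] was claimed earlier by Staller, then
   the preimage of [x] was not, since the answer to it would have been [x]. *)
Lemma outcome_D_of_injection (f : T -> T) :
  injective f -> (forall x, e x (f x)) -> outcome_D e.
Proof.
move=> f_inj fE b.
pose h := invF f_inj.
have fh x : f (h x) = x by apply: f_invF.
have hE x : e x (h x) by rewrite e_sym -{2}(fh x) fE.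
pose free (p : seq T) := [pick v | v \notin p].
(* Only the last claimed vertex matters; [free] serves for the opening move and when both preferred
   answers are taken. *)
pose s (p : seq T) : option T :=
  if p is x :: q then
    let y := last x q in
    if f y \notin p then Some (f y) else
    if h y \notin p then Some (h y) else free p
  else free p.
exists s; split=> [p Up _ ltp _|p Up szp follow].
  have freeP : exists2 v, free p = Some v & v \notin p.
    rewrite /free; case: pickP => [v vp | all_p]; first by exists v.
    suff: #|T| <= size p by lia.
    apply: leq_trans (card_size p); apply/subset_leq_card/subsetP => v _.
    by have := all_p v; rewrite /= => /negbFE.
  rewrite /s; case: p Up ltp freeP => // x q Up ltp freeP.
  case: ifP => [fy|_]; first by exists (f (last x q)).
  by case: ifP => [hy|_]; first by exists (h (last x q)).
have inp v : v \in p.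
  have [_ pT] := uniq_min_size Up (fun x _ => mem_enum T x)
    (eq_leq (etrans (esym (cardE T)) (esym szp))).
  by rewrite pT mem_enum.
exists (size p) => // v.
have clE u : (u \in dominator_claims b (take (size p) p)) =
    dominator_turn b (index u p) by rewrite take_size inE inp.
have before u i : (u \in take i p) = (index u p < i).
  exact: in_take.
rewrite clE => vS.
have sE u : let q := take (index u p).+1 p in s q =
    if f u \notin q then Some (f u) else
    if h u \notin q then Some (h u) else free q.
  have := nth_index u (inp u); move: (inp u); rewrite -index_mem.
  case: (p) => // x r; move: (index u _) => i lt_i nth_i.
  by rewrite /s /= (last_nth u) size_takel // (nth_take u (ltnSn i) (x :: r)) nth_i.
have answer u w : ~~ dominator_turn b (index u p) ->
    index u p < index w p -> s (take (index u p).+1 p) = Some w ->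
    dominator_turn b (index w p).
  move=> uS lt_uw sw.
  have ut : dominator_turn b (index u p).+1.
    by move: uS; rewrite /dominator_turn /= addbN.
  have lt_u : (index u p).+1 < size p.
    by apply: leq_ltn_trans lt_uw _; rewrite index_mem.
  have := follow _ lt_u ut; rewrite sw => /esym/(onth_nth u) <-.
  by rewrite index_uniq.
have neq_idx u w : u != w -> index u p != index w p.
  by apply: contraNneq => /(congr1 (nth u p)); rewrite !nth_index // => ->.
have neq u w : e u w -> u != w by apply: contraTneq => ->; rewrite e_irr.
have late u : ~~ dominator_turn b (index u p) -> index u p < index (f u) p ->
    dominator_turn b (index (f u) p).
  by move=> uS lt_u; apply: (answer u); rewrite // sE before ltnS -ltnNge lt_u.
have [fvD | fvS] := boolP (dominator_turn b (index (f v) p)).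
  by exists (f v); rewrite ?clE // e_sym.
have [hvD | hvS] := boolP (dominator_turn b (index (h v) p)).
  by exists (h v); rewrite ?clE // e_sym.
(* If neither [f v] nor [h v] is Dominator's, then [f v] was claimed before [v] and [h v] after it,
   so her answer to [v] was [h v] after all. *)
have lt_fv : index (f v) p < index v p.
  rewrite ltn_neqAle neq_idx 1?eq_sym ?neq //= leqNgt.
  by apply: contra fvS; apply: late.
have lt_hv : index v p < index (h v) p.
  rewrite ltn_neqAle neq_idx ?neq //= leqNgt.
  by apply: contra vS => lt_hv; have := late (h v); rewrite fh; apply.
case/negP: hvS; apply: (answer v) => //.
by rewrite sE !before !ltnS -!ltnNge [index v p < _]ltnNge (ltnW lt_fv) lt_hv.
Qed.

(** * 2-connected subgraphs of block graphs *)

Lemma connected_on_path (V : {set T}) (g : rel T) x p :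
  symmetric g -> path g x p -> V =i x :: p -> connected_on V g.
Proof.
move=> g_sym gp VE; pose r := [rel u v | [&& u \in V, v \in V & g u v]].
have r_sym : symmetric r by move=> u v; rewrite /r /= g_sym andbCA.
have rp : path r x p.
  apply: (sub_in_path (P := mem V)) gp => [u v uV vV guv|].
    exact/and3P.
  by apply/allP => u; rewrite -VE.
have xto y : y \in V -> connect r x y by rewrite VE; apply: path_connect.
move=> y z yV zV; apply: connect_trans (xto z zV).
by rewrite sym_connect_sym // xto.
Qed.

Lemma connected_on_mono (V : {set T}) (g g' : rel T) :
  {in V &, subrel g g'} -> connected_on V g -> connected_on V g'.
Proof.
move=> gg' conn x y xV yV; apply: connect_sub (conn x y xV yV) => u v.
by case/and3P=> uV vV guv; apply: connect1; rewrite /= uV vV gg'.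
Qed.

Definition induced_edge (V : {set T}) : rel T :=
  [rel x y | [&& e x y, x \in V & y \in V]].

Lemma induced_edge_sym V : symmetric (induced_edge V).
Proof. by move=> x y; rewrite /induced_edge /= e_sym [(x \in V) && _]andbC. Qed.

Definition induced (V : {set T}) : subgraph e :=
  Subgraph (@induced_edge_sym V) (fun x y => @and3P _ _ _).

(** A cycle minus a vertex is a path: rotating the deleted vertex to the front exhibits it. Chords
    do no harm. *)
Lemma two_connected_cycle c :
  uniq c -> cycle e c -> two_connected (induced [set x in c]).
Proof.
move=> Uc cyc; set V := [set x in c].
have icyc : cycle (induced_edge V) c.
  apply: sub_in_cycle (allss c) cyc => x y xc yc exy.
  by rewrite /induced_edge /= exy !inE xc.
split=> [|z] /=.
  case: c => [|x p] in V Uc cyc icyc *; first by move=> x; rewrite inE.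
  apply: (connected_on_path (@induced_edge_sym V) (x := x) (p := p)).
    by move: icyc; rewrite /= rcons_path => /andP[].
  by move=> y; rewrite inE.
rewrite inE => /rot_to[i p rotc].
have pE y : (y \in V :\ z) = (y \in p).
  have := rot_uniq i c; rewrite rotc Uc /= => /andP[zp _].
  rewrite !inE -(mem_rot i) rotc inE; have [->|//] := eqVneq.
  by rewrite (negPf zp).
move: icyc; rewrite -(rot_cycle i) rotc /=.
case: p => [|y p] in rotc pE *; first by move=> _ x; rewrite pE.
rewrite /= rcons_path => /andP[_ /andP[py _]].
exact: connected_on_path (@induced_edge_sym V) py pE.
Qed.

(** [block_graph] speaks only of maximal subgraphs, so the set is enlarged, by induction on the size
    of its complement. A 2-connected [K] on more vertices stays 2-connected when replaced by the
    induced subgraph; if there is none, [induced V] is itself a component. *)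
Lemma two_connected_adjacent (V : {set T}) : block_graph e ->
  two_connected (induced V) -> {in V &, forall x y, x != y -> e x y}.
Proof.
move=> blk tcV x y; have [n] := ubnP #|~: V|.
elim: n V tcV => // n IHn V tcV ltn xV yV xy.
apply/negPn/negP => nexy.
suff /blk /(_ x y xV yV xy) /and3P[exy _ _] :
    two_connected_component (induced V).
  by rewrite exy in nexy.
split=> // K [K1 K2] [/= VK _].
have KV : sg_vert K = V.
  apply/eqP; rewrite eq_sym eqEsubset VK; apply: contraR nexy => nKV.
  apply: (IHn (sg_vert K)) xy; try exact: (subsetP VK).
    split=> [|z /K2] /=; first apply: connected_on_mono K1.
      by move=> u v _ _ /sg_sub[*]; apply/and3P.
    by apply: connected_on_mono => u v _ _ /sg_sub[*]; apply/and3P.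
  rewrite -ltnS; apply: leq_trans ltn; rewrite ltnS; apply: proper_card.
  by rewrite properC properE VK.
split=> [|u v /sg_sub]; rewrite KV //= => - [*]; exact/and3P.
Qed.

(** * Cycles and leaves *)

(** A path is extended at its head [x]. If two neighbours of [x] already lie on the path, one of
    them is not the second vertex and closes a cycle of length at least three. Otherwise the path
    grows, which the finiteness of [T] bounds. *)
Lemma min_degree_cycle (h : rel T) (A : {set T}) x0 :
    symmetric h -> irreflexive h -> x0 \in A ->
    {in A, forall x, 1 < #|[set y in A | h x y]|} ->
  exists c, [/\ uniq c, 2 < size c & cycle h c].
Proof.
move=> h_sym h_irr x0A degA.
have long n : (exists c, [/\ uniq c, 2 < size c & cycle h c]) \/
    exists x p, [/\ uniq (x :: p), size p = n, path h x p & x \in A].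
  elim: n => [|n [|[x [p [Up szp hp xA]]]]].
  - by right; exists x0, [::].
  - by left.
  have [y1 [y2 [/setIdP[y1A hy1] /setIdP[y2A hy2] y12]]] :=
    card_gt1P (degA x xA).
  have extend y : y \in A -> h x y -> y \notin p ->
      exists x p, [/\ uniq (x :: p), size p = n.+1, path h x p & x \in A].
    move=> yA hxy yp; exists y, (x :: p); split=> //=; rewrite ?szp //.
      rewrite -/(uniq (x :: p)) Up andbT inE negb_or yp andbT.
      by apply: contraTneq hxy => ->; rewrite h_irr.
    by rewrite h_sym hxy.
  have [y1p | /extend] := boolP (y1 \in p); last by right; auto.
  have [y2p | /extend] := boolP (y2 \in p); last by right; auto.
  left; have [y [yp hxy yhead]] : exists y, [/\ y \in p, h x y & y != head x p].
    by have [y1h | ] := eqVneq y1 (head x p);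
      [exists y2; rewrite -y1h eq_sym | exists y1].
  move: Up hp yhead; case/splitPr: yp => q1 q2 Up hp yhead.
  exists (x :: rcons q1 y); split.
  - by move: Up; rewrite -cat_rcons -cat_cons cat_uniq => /andP[].
  - by case: q1 yhead {Up hp} => [|z q1]; rewrite /= ?eqxx ?size_rcons.
  - move: hp; rewrite -cat_rcons cat_path => /andP[hp _].
    by rewrite /= rcons_path hp last_rcons h_sym.
have [//|[x [p [Up szp _ _]]]] := long #|T|.
by have := max_card (mem (x :: p)); rewrite (card_uniqP Up) /= szp ltnn.
Qed.

(* A block contains at most one vertex of an independent set [I], so the
   bipartite graph of the edges between [I] and [J] is a forest. *)
Lemma bipartite_leaf (I J : {set T}) :
    block_graph e -> {in I &, forall x y, ~~ e x y} -> [disjoint I & J] ->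
    I != set0 ->
  (exists2 x, x \in I & #|[set y in J | e x y]| <= 1) \/
  (exists2 y, y \in J & #|[set x in I | e y x]| <= 1).
Proof.
move=> blk indI dIJ /set0Pn[x0 x0I].
have [/exists_inP|noI] := boolP [exists x in I, #|[set y in J | e x y]| <= 1].
  by left.
have [/exists_inP|noJ] := boolP [exists y in J, #|[set x in I | e y x]| <= 1].
  by right.
exfalso.
pose h := [rel x y |
  e x y && ((x \in I) && (y \in J) || (x \in J) && (y \in I))].
have h_sym : symmetric h.
  by move=> x y; rewrite /= e_sym orbC andbC [in RHS]andbC; congr (_ && _);
    rewrite andbC [X in _ || X]andbC.
have h_irr : irreflexive h by move=> x; rewrite /= e_irr.
have deg : {in I :|: J, forall x, 1 < #|[set y in I :|: J | h x y]|}.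
  move=> x /setUP[xI | xJ]; rewrite ltnNge.
    move/exists_inPn/(_ x xI): noI; apply: contra; apply: leq_trans.
    apply/subset_leq_card/subsetP => y; rewrite !inE /= => /andP[-> ->].
    by rewrite xI !orbT.
  move/exists_inPn/(_ x xJ): noJ; apply: contra; apply: leq_trans.
  apply/subset_leq_card/subsetP => y; rewrite !inE /= => /andP[-> ->].
  by rewrite xJ !orbT.
have x0A : x0 \in I :|: J by rewrite inE x0I.
have [c [Uc c_gt2 hc]] := min_degree_cycle h_sym h_irr x0A deg.
have ec : cycle e c by apply: sub_cycle hc => x y /andP[].
have adj x y : x \in c -> y \in c -> x \in I -> y \in I -> x = y.
  move=> xc yc xI yI; apply: contraTeq (indI x y xI yI) => xy.
  rewrite negbK; apply: (two_connected_adjacent blk (two_connected_cycle Uc ec));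
    by rewrite ?inE.
have alt x y : h x y -> (y \in I) = (x \notin I).
  case/andP=> _ /orP[] /andP[].
    by move=> -> yJ; rewrite (disjointFl dIJ yJ).
  by move=> xJ ->; rewrite (disjointFl dIJ xJ).
(* The cycle alternates between [I] and [J], so it has two distinct vertices of [I], against [adj]:
   [a] and [d] if [a] is in [I], else [b] and the successor [g] of [d]. A triangle cannot
   alternate. *)
case: c Uc c_gt2 hc adj {ec} => [|a [|b [|d c]]] //= Uc _ /and3P[hab hbd hc] adj.
have dI : (d \in I) = (a \in I) by rewrite (alt _ _ hbd) (alt _ _ hab) negbK.
have [aI | aI] := boolP (a \in I).
  have ad : a = d by apply: adj; rewrite ?inE ?eqxx ?orbT ?dI.
  by move: Uc; rewrite ad !inE eqxx !orbT.
have bI : b \in I by rewrite (alt _ _ hab).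
case: c => [|g c] /= in Uc hc adj *.
  by move: hc; rewrite andbT => /alt; rewrite dI (negPf aI).
case/andP: hc => /alt; rewrite dI aI => gI _.
have bg : b = g by apply: adj; rewrite ?inE ?eqxx ?orbT.
by move: Uc; rewrite bg !inE eqxx !orbT !andbF.
Qed.

(** * Plays and Staller's strategy *)

Section Play.

Variables (b : bool) (s : strategy T).

Lemma follows_rcons p x : follows b s p ->
  (dominator_turn b (size p) -> s p = Some x) -> follows b s (rcons p x).
Proof.
move=> fp sp i; rewrite size_rcons ltnS leq_eqVlt => /predU1P[-> | lti] turn.
  by rewrite -cats1 take_size_cat // onth_cat ltnn subnn sp.
by rewrite -cats1 takel_cat 1?ltnW // onth_cat lti fp.
Qed.

(** [winning_strategy] promises a win only on plays that claim every vertex, so partial plays must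
    be prolonged before it applies. Staller's further moves are arbitrary. *)
Lemma complete_play p : legal_strategy b s -> uniq p -> follows b s p ->
  exists q, [/\ uniq (p ++ q), size (p ++ q) = #|T| & follows b s (p ++ q)].
Proof.
move=> leg; have [n] := ubnP (#|T| - size p).
elim: n p => // n IHn p ltn Up fp.
have : size p <= #|T| by rewrite -(card_uniqP Up) max_card.
rewrite leq_eqVlt => /predU1P[szp | ltp]; first by exists [::]; rewrite cats0.
have [v vp sv] : exists2 v, v \notin p &
    (dominator_turn b (size p) -> s p = Some v).
  have [turn | _] := boolP (dominator_turn b (size p)).
    by have [v sv vp] := leg p Up fp ltp turn; exists v.
  have [v vp | p_all] := pickP [predC p]; first by exists v.
  suff: #|T| <= size p by lia.
  apply: leq_trans (card_size p); apply/subset_leq_card/subsetP => v _.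
  by have /negbFE := p_all v.
have [|||q [Uq szq fq]] := IHn (rcons p v).
- by rewrite size_rcons; lia.
- by rewrite rcons_uniq vp.
- exact: follows_rcons.
by exists (v :: q); rewrite -cat_rcons.
Qed.

Definition staller_claims (p : seq T) : {set T} :=
  [set x in p | ~~ dominator_turn b (index x p)].

Lemma staller_claims_cat p q x :
  x \in staller_claims p -> x \in staller_claims (p ++ q).
Proof. by rewrite !inE mem_cat index_cat => /andP[-> ->]. Qed.

Lemma staller_claims_new p x : x \notin p -> ~~ dominator_turn b (size p) ->
  x \in staller_claims (rcons p x).
Proof.
move=> xp turn; rewrite inE mem_rcons mem_head -cats1 index_cat (negPf xp) /=.
by rewrite eqxx addn0.
Qed.

(** Staller keeps the closed neighbourhood of [v] in every completion of the play, so Dominator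
    dominates [v] at no stage of it. *)
Lemma no_staller_win p v : winning_strategy e b s -> uniq p -> follows b s p ->
  (forall u, u = v \/ e v u -> u \in staller_claims p) -> False.
Proof.
move=> [leg win] Up fp stv; have [q [Uq szq fq]] := complete_play leg Up fp.
have [k _ domk] := win _ Uq szq fq.
have st u : u = v \/ e v u -> u \notin dominator_claims b (take k (p ++ q)).
  move=> /stv /(@staller_claims_cat p q); set r := p ++ q.
  rewrite -{1}(cat_take_drop k r) inE => /andP[_]; apply: contra.
  by rewrite inE index_cat => /andP[->].
have [u uD evu] := domk v (st v (or_introl erefl)).
by move: (st u); rewrite uD e_sym; auto.
Qed.

(* Staller claims the last unclaimed neighbour in [J] of some [v] in [I], which
   forces Dominator to answer [v]; this removes one vertex from both sets. *)
Lemma staller_wins (I J : {set T}) (p : seq T) :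
    block_graph e -> winning_strategy e b s ->
    uniq p -> follows b s p -> ~~ dominator_turn b (size p) ->
    {in I &, forall x y, ~~ e x y} -> [disjoint I & J] ->
    {in I, forall v u, e v u -> u \in J :|: staller_claims p} ->
    {in I :|: J, forall x, x \notin p} ->
  #|I| <= #|J|.
Proof.
move=> blk win; have [n] := ubnP #|J|; elim: n I J p => // n IHn I J p ltJ.
move=> Up fp turn indI dIJ nbI free; rewrite leqNgt; apply/negP => ltJI.
have I0 : I != set0 by rewrite -card_gt0; apply: leq_trans ltJI.
have indD A : {in I :\: A &, forall x y, ~~ e x y}.
  by move=> x y /setDP[xI _] /setDP[yI _]; apply: indI.
have disjD A B : [disjoint I :\: A & J :\: B].
  by apply: disjointWl (disjointWr _ dIJ); apply: subsetDl.
have ltJD j : j \in J -> #|J :\ j| < n.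
  by move=> jJ; rewrite -ltnS; apply: leq_trans ltJ; rewrite (cardsD1 j J) jJ.
case: (bipartite_leaf blk indI dIJ I0) => [[v vI degv] | [j jJ degj]].
  have vp : v \notin p by apply: free; rewrite inE vI.
  (* Once Staller holds all neighbours of the free vertex [v] and is to move, she claims [v]
     itself. *)
  have win_at q : uniq q -> follows b s q -> ~~ dominator_turn b (size q) ->
      v \notin q -> (forall u, e v u -> u \in staller_claims q) -> False.
    move=> Uq fq turnq vq stq.
    apply: (@no_staller_win (rcons q v) v) => //.
    - by rewrite rcons_uniq vq.
    - by apply: follows_rcons; rewrite // (negPf turnq).
    - move=> u [-> | /stq]; first exact: staller_claims_new.
      by rewrite -cats1; apply: staller_claims_cat.
  have [Nv0 | [j]] := set_0Vmem [set y in J | e v y].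
    apply: (win_at p) => // u evu; have /setUP[uJ | //] := nbI v vI u evu.
    by have := in_set0 u; rewrite -Nv0 inE uJ evu.
  rewrite inE => /andP[jJ evj].
  have jp : j \notin p by apply: free; rewrite inE jJ orbT.
  have vj : v != j by apply: contraTneq evj => ->; rewrite e_irr.
  set p1 := rcons p j.
  have Up1 : uniq p1 by rewrite rcons_uniq jp.
  have fp1 : follows b s p1 by apply: follows_rcons; rewrite // (negPf turn).
  have vp1 : v \notin p1 by rewrite mem_rcons inE negb_or vj.
  have jp1 : j \in staller_claims p1 by apply: staller_claims_new.
  have turn1 : dominator_turn b (size p1).
    by move: turn; rewrite size_rcons /dominator_turn /= addbN.
  (* The vertex [v] is still free, so Dominator has a legal answer [d]. *)
  have ltp1 : size p1 < #|T|.
    have Uv : uniq (v :: p1) by rewrite /= vp1.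
    by have := max_card (mem (v :: p1)); rewrite (card_uniqP Uv).
  have [d sd dp1] := win.1 p1 Up1 fp1 ltp1 turn1.
  set p2 := rcons p1 d.
  have Up2 : uniq p2 by rewrite rcons_uniq dp1.
  have fp2 : follows b s p2 by apply: follows_rcons; rewrite // sd.
  have turn2 : ~~ dominator_turn b (size p2).
    by move: turn1; rewrite [size p2]size_rcons /dominator_turn /= addbN => ->.
  have sub2 u : u \in staller_claims p1 -> u \in staller_claims p2.
    by rewrite /p2 -cats1; apply: staller_claims_cat.
  have sub02 u : u \in staller_claims p -> u \in staller_claims p2.
    by move=> up; apply: sub2; rewrite /p1 -cats1; apply: staller_claims_cat.
  (* If Dominator takes [v], induction applies to [I :\ v] and [J :\ j]; otherwise Staller takes [v]
     next, [j] having been its only neighbour in [J]. *)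
  have [dv | dv] := eqVneq d v.
    move: ltJI; rewrite (cardsD1 v I) (cardsD1 j J) vI jJ !add1n ltnS ltnNge.
    case/negP; apply: (IHn _ _ p2 (ltJD j jJ)) => // [w /setDP[wI _] u /(nbI w wI) | w].
      rewrite !inE; have [-> _ | _] := eqVneq u j.
        by have := sub2 j jp1; rewrite inE.
      by case/orP=> [->//|]; have := sub02 u; rewrite !inE => + up => ->; rewrite ?orbT.
    rewrite !inE => wIJ; rewrite mem_rcons inE mem_rcons inE dv.
    have wp : w \notin p.
      by apply: free; rewrite inE; case/orP: wIJ => /andP[_ ->]; rewrite ?orbT.
    rewrite !negb_or wp andbT; case/orP: wIJ => /andP[wn wm]; rewrite wn ?andbT /=.
      by apply: contraTneq wm => ->; rewrite (disjointFl dIJ jJ).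
    by apply: contraTneq wm => ->; rewrite (disjointFr dIJ vI).
  apply: (win_at p2) => // [|u evu].
    by rewrite mem_rcons inE negb_or eq_sym dv.
  have /setUP[uJ | /sub02 //] := nbI v vI u evu.
  apply: sub2; suff -> : u = j by [].
  by apply: (card_le1_eqP degv); rewrite inE ?uJ ?jJ.
(* A leaf [j] of [J] costs no move: [j] and its at most one neighbour in [I] are dropped, and the
   remaining vertices of [I] are not adjacent to [j]. *)
have rec (A : {set T}) :
    #|I :&: A| <= 1 -> (forall w, w \in I -> e w j -> w \in A) -> False.
  move=> A1 Aj.
  have: #|J| < #|I :\: A|.+1.
    by apply: leq_trans ltJI _; rewrite -(cardsID A I) -add1n leq_add2r.
  rewrite (cardsD1 j J) jJ add1n ltnS ltnNge => /negP[].
  apply: (IHn _ _ p (ltJD j jJ)) => // [w /setDP[wI wA] u ewu | w wIJ].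
    have := nbI w wI u ewu; rewrite !inE => /orP[-> | ->]; last by rewrite orbT.
    rewrite andbT; suff -> : u != j by [].
    by apply: contraNneq wA => uj; apply: Aj; rewrite // -uj.
  apply: free; move: wIJ; rewrite !inE.
  by case/orP=> /andP[_ ->]; rewrite ?orbT.
apply: (rec [set x in I | e j x]) => [|w wI ewj].
  by rewrite (setIidPr _) //; apply/subsetP => w; rewrite inE => /andP[].
by rewrite inE wI e_sym.
Qed.

End Play.

End Graph.

Theorem theorem3p8 (T : finType) (e : rel T)
    (e_sym : symmetric e) (e_irr : irreflexive e) :
  block_graph e ->
  (outcome_D e <-> exists F : subgraph e, perfect_12_factor F).
Proof.
move=> blk; split=> [outD | [F /injection_of_factor[f f_inj fE]]]; last first.
  exact: (outcome_D_of_injection e_sym e_irr f_inj fE).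
have [[f f_inj fE] | no_f] :
    (exists2 f : T -> T, injective f & forall x, e x (f x)) \/
    (forall f : T -> T, injective f -> ~ forall x, e x (f x)).
  have [/existsP[f /andP[/injectiveP f_inj /forallP fE]] | /existsPn no_f] :=
    boolP [exists f : {ffun T -> T}, injectiveb f && [forall x, e x (f x)]].
    by left; exists f.
  right=> f f_inj fE; case/negP: (no_f (finfun f)); apply/andP; split.
    by apply/injectiveP => x y; rewrite !ffunE; apply: f_inj.
  by apply/forallP => x; rewrite ffunE.
  exact: (factor_of_injection e_sym e_irr f_inj fE).
have [I [indI ltI]] := deficient_independent_set e_sym no_f.
(* With [false] Staller opens, so the empty play is at her turn, and [J] is the whole neighbourhood
   of [I]. *)
have [s win] := outD false.
move: ltI; rewrite ltnNge => /negP[].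
apply: (staller_wins e_sym e_irr (p := [::]) blk win) => //.
- apply/pred0P => y /=; rewrite inE; apply: contraFF (erefl false).
  by case/andP=> yI /exists_inP[x xI exy]; have := indI x y xI yI; rewrite exy.
- move=> v vI u evu; rewrite !inE; apply/orP; left.
  by apply/exists_inP; exists v.
Qed.
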